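(* Let $m$ be a nonnegative integer and let $\alpha,b,b_1,\dots,b_m,c_1,\dots,c_m$ be complex numbers with $\max\{|\alpha b|,|\alpha b_1|,\dots,|\alpha b_m|\}<1$. Then $$\frac{(\alpha q;q)_\infty}{(\alpha b;q)_\infty}\prod_{j=1}^m\frac{(\alpha c_j;q)_\infty}{(\alpha b_j;q)_\infty} =\sum_{n=0}^\infty\frac{(1-\alpha q^{2n})(\alpha;q)_n(-1)^nq^{n(n-1)/2}}{(1-\alpha)(q;q)_n}\;{}_{m+2}\phi_{m+1}\left({q^{-n},\alpha q^n,\alpha c_1,\dots,\alpha c_m\atop \alpha b,\alpha b_1,\dots,\alpha b_m};q,q\right).$$
   Context: Throughout $0<q<1$. Put $(x;q)_0=1$, $(x;q)_n=\prod_{k=0}^{n-1}(1-xq^k)$, $(x;q)_\infty=\prod_{k\ge0}(1-xq^k)$, and $(x_1,\dots,x_r;q)_n=(x_1;q)_n\cdots(x_r;q)_n$. The basic hypergeometric series is $${}_{r+1}\phi_r\left({a_1,\dots,a_{r+1}\atop b_1,\dots,b_r};q,z\right)=\sum_{k=0}^\infty\frac{(a_1,\dots,a_{r+1};q)_k}{(q,b_1,\dots,b_r;q)_k}z^k ;$$ when some $a_i=q^{-n}$ with $n\ge 0$ an integer, it is the finite sum over $0\le k\le n$. The factor $(1-\alpha q^{2n})(\alpha;q)_n/(1-\alpha)$ means $1$ for $n=0$ and $(1-\alpha q^{2n})(\alpha q;q)_{n-1}$ for $n\ge1$, also for $\alpha=1$. *)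

(* Defs.v *)
From HB Require Import structures.
From mathcomp Require Import all_boot all_order all_algebra complex.
From mathcomp Require Import all_classical all_reals all_analysis.

Set Implicit Arguments.
Unset Strict Implicit.
Unset Printing Implicit Defensive.

Import Order.TTheory GRing.Theory Num.Theory.
Import numFieldNormedType.Exports.

Local Open Scope classical_set_scope.
Local Open Scope ring_scope.

(* The definitions are over an arbitrary numFieldType [K], whose topology is
   that of the norm. They are meant to be used with [K := R[i]] for
   [R : realType]; the copy [K^o] is where [R[i]] carries that topology. *)
Section QSeries.
Variables (K : numFieldType) (q : K).

(* (x;q)_n *)
Definition qpoch (x : K) (n : nat) : K := \prod_(k < n) (1 - x * q ^+ k).

(* (x;q)_oo; the limit exists for every [x] as soon as [`|q| < 1] *)
Definition qpoch_inf (x : K) : K := lim ((qpoch x : nat -> K^o) @ \oo).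

(* (x_1, ..., x_r; q)_n *)
Definition qpochs (xs : seq K) (n : nat) : K := \prod_(x <- xs) qpoch x n.

Definition hyper_term (r : nat) (a : r.+1.-tuple K) (b : r.-tuple K) (z : K)
    (k : nat) : K :=
  qpochs a k / qpochs (q :: b) k * z ^+ k.

(* The series {r+1}phi_r; see [hyper_terminating] for the finite case. *)
Definition hyper (r : nat) (a : r.+1.-tuple K) (b : r.-tuple K) (z : K) : K :=
  lim (series (hyper_term a b z : nat -> K^o) @ \oo).

(* (1 - alpha q^(2n)) (alpha;q)_n / (1 - alpha), with the factor 1 - alpha
   cancelled so that alpha = 1 is allowed; see [well_poisedE]. *)
Definition well_poised (alpha : K) (n : nat) : K :=
  if n is n'.+1 then (1 - alpha * q ^+ (2 * n)) * qpoch (alpha * q) n' else 1.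

Lemma well_poisedE (alpha : K) (n : nat) : alpha != 1 ->
  well_poised alpha n =
    (1 - alpha * q ^+ (2 * n)) * qpoch alpha n / (1 - alpha).
Proof.
move=> al1; have al0 : 1 - alpha != 0 by rewrite subr_eq0 eq_sym.
case: n => [|n]; first by rewrite /qpoch big_ord0 expr0 !mulr1 divff.
rewrite /well_poised -mulrA; congr (_ * _).
rewrite [in RHS]/qpoch big_ord_recl expr0 mulr1 mulrAC divff // mul1r.
by apply: eq_bigr => i _; rewrite exprS mulrA.
Qed.

Lemma hyper_terminating (r : nat) (a : r.+1.-tuple K) (b : r.-tuple K) (z : K)
    (n : nat) : q != 0 -> q ^- n \in (a : seq K) ->
  hyper a b z = \sum_(k < n.+1) hyper_term a b z k.
Proof.
move=> q0 an.
have term0 k : (n < k)%N -> hyper_term a b z k = 0.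
  move=> nk; rewrite /hyper_term /qpochs (big_rem (q ^- n)) //=.
  rewrite [qpoch (q ^- n) k](bigD1 (Ordinal nk)) //=.
  by rewrite mulVf ?expf_neq0 // subrr !mul0r.
apply: cvg_lim => //; apply: cvg_near_cst; exists n.+1 => // N /= nN.
rewrite seriesEnat /= (big_cat_nat (n := n.+1)) //= big_mkord.
rewrite [X in _ + X]big_nat_cond [X in _ + X]big1 ?addr0 //.
by move=> k /andP[/andP[nk _] _]; rewrite term0.
Qed.

End QSeries.

(* Main.v *)
Require Import Defs.
From mathcomp Require Import all_boot all_order all_algebra complex.
From mathcomp Require Import all_classical all_reals all_analysis.
From mathcomp Require Import ring zify.

Set Implicit Arguments.
Unset Strict Implicit.
Unset Printing Implicit Defensive.

Import Order.TTheory GRing.Theory Num.Theory.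
Import numFieldNormedType.Exports.

Local Open Scope classical_set_scope.
Local Open Scope ring_scope.
Local Open Scope complex_scope.

(** The parameters [b], [b_j] and [c_j] enter only through the sequence
      [g k = (alpha c_1, ..., alpha c_m; q)_k
             / (alpha b, alpha b_1, ..., alpha b_m; q)_k],
    and the identity holds for every convergent sequence [g] in its place: the
    series then sums to [(alpha q; q)_oo] times the limit of [g]
    ([cvg_expansion]).

    Exchanging the two sums outright is not allowed. The double series does not
    converge absolutely, and the coefficient of each single [g k], a limiting
    case of the well-poised 6phi5 series, sums over [n] to 0. That sum
    telescopes, though, so the exchange can be made in the partial sum over
    [n <= N], which becomes ([partial_sumE])
      [sum_(k <= N) W N k * g k * (alpha q; q)_(N + k)],
      [W N k = (-1)^(N-k) q^('C(N-k+1, 2)) / ((q; q)_k (q; q)_(N-k))].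
    The weights [W N k] do not depend on [alpha] or [g], and for each [N] they
    sum to 1, by the finite q-binomial theorem at [x = q] ([sum_qweight]). They
    are bounded by a multiple of [q^(N-k)], so they concentrate on the indices
    [k] close to [N], where [g k * (alpha q; q)_(N + k)] is close to its limit.
    Toeplitz' theorem on regular summation methods ([toeplitz]) concludes.

    What remains is that the infinite products converge, and that those in the
    denominator do not vanish. Both follow from one convergence criterion for
    products of factors [1 + a k] with [a k = O(q^k)] ([cvg_prod1D]), applied to
    [(x; q)_n] and, when [|x| < 1], to its inverse. *)

(** * The partial sums as weighted means *)

Section Algebra.
Variables (K : numFieldType) (q : K).

Lemma qpoch0 x : qpoch q x 0 = 1.
Proof. by rewrite /qpoch big_ord0. Qed.

Lemma qpochS x n : qpoch q x n.+1 = qpoch q x n * (1 - x * q ^+ n).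
Proof. by rewrite /qpoch big_ord_recr. Qed.

Lemma qpochD x m n : qpoch q x (m + n) = qpoch q x m * qpoch q (x * q ^+ m) n.
Proof.
elim: n => [|n IHn]; first by rewrite addn0 qpoch0 mulr1.
by rewrite addnS !qpochS IHn mulrA -mulrA exprD !mulrA.
Qed.

Hypotheses (q0 : q != 0) (qq0 : forall n, qpoch q q n != 0).

Let qpochqS n : qpoch q q n.+1 = qpoch q q n * (1 - q ^+ n.+1).
Proof. by rewrite qpochS -exprS. Qed.

Let oneBq0 n : 1 - q ^+ n.+1 != 0.
Proof. by have := qq0 n.+1; rewrite qpochqS mulf_eq0 => /norP[]. Qed.

(** The finite q-binomial theorem
      [(x; q)_N = sum_j (-1)^j q^('C(j, 2)) [N choose j]_q x^j],
    divided by [(q; q)_N] so that only q-Pochhammer symbols occur. *)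
Lemma q_binomial x N :
  \sum_(j < N.+1) (-1) ^+ j * q ^+ 'C(j, 2) * x ^+ j
     / (qpoch q q j * qpoch q q (N - j)) = qpoch q x N / qpoch q q N.
Proof.
elim: N => [|N IHN].
  by rewrite big_ord_recl big_ord0 /= subn0 !qpoch0 !expr0 addr0 !mulr1.
apply: (mulIf (oneBq0 N)); rewrite mulr_suml.
pose lo (j : nat) : K := (-1) ^+ j * q ^+ 'C(j, 2) * x ^+ j
  / (qpoch q q j * qpoch q q (N - j)).
(* q-Pascal rule: 1 - q^(N+1) = (1 - q^(N+1-j)) + q^(N+1-j) (1 - q^j), and
   each part cancels one factor of the denominator. *)
have split_term (j : 'I_N.+2) :
  (-1) ^+ j * q ^+ 'C(j, 2) * x ^+ j
     / (qpoch q q j * qpoch q q (N.+1 - j)) * (1 - q ^+ N.+1)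
  = (if (j < N.+1)%N then lo j else 0)
    - (if (j : nat) is i.+1 then x * q ^+ N * lo i else 0).
  rewrite /lo; case: j => [[|j] /= jN].
    rewrite !subn0 subr0 qpochqS qpoch0 /= !expr0; field.
    by rewrite qq0 oneBq0.
  rewrite subSS; have [jN'|] := ltnP j N; last first.
    move=> Nj; have -> : j = N by lia.
    rewrite ltnn subnn qpoch0 qpochqS binS bin1 exprD !exprS; field.
    by rewrite qq0 -exprS oneBq0.
  rewrite ltnS jN' subnS.
  case E : (N - j)%N => [|i]; first by lia.
  have -> : q ^+ N.+1 = q ^+ i.+1 * q ^+ j.+1 by rewrite -exprD; congr (_ ^+ _); lia.
  have -> : q ^+ N = q ^+ i.+1 * q ^+ j by rewrite -exprD; congr (_ ^+ _); lia.
  rewrite /= !qpochqS binS bin1 exprD !(exprS (-1)) (exprS x); field.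
  by rewrite !qq0 !oneBq0.
rewrite (eq_bigr _ (fun j _ => split_term j)) sumrB.
rewrite [X in X - _]big_ord_recr /= ltnn addr0.
rewrite [X in _ - X]big_ord_recl /= add0r.
rewrite -mulr_sumr (eq_bigr (fun j : 'I__ => lo j)) => [|j _]; last by rewrite ltn_ord.
by rewrite IHN qpochqS qpochS; field; rewrite qq0 oneBq0.
Qed.

Definition qweight N k : K :=
  (-1) ^+ (N - k) * q ^+ 'C((N - k).+1, 2) / (qpoch q q k * qpoch q q (N - k)).

Lemma sum_qweight N : \sum_(k < N.+1) qweight N k = 1.
Proof.
have := q_binomial q N; rewrite divff // => <-.
rewrite (reindex_inj rev_ord_inj) /=; apply: eq_bigr => k _.
rewrite /qweight subSS subKn; last by rewrite -ltnS.
by rewrite binS bin1 exprD mulrA [qpoch q q (N - k) * _]mulrC.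
Qed.

(** Reversal of [(q^-n; q)_k] into [(q; q)_(n-k)]: this removes the negative
    powers of [q], and shows that the powers of [q] in the double series depend
    on [n - k] only. *)
Lemma qpoch_qVn n k : (k <= n)%N ->
  (-1) ^+ n * q ^+ 'C(n, 2) / qpoch q q n * qpoch q (q ^- n) k * q ^+ k
  = (-1) ^+ (n - k) * q ^+ 'C(n - k, 2) / qpoch q q (n - k).
Proof.
elim: k => [_|k IHk kn]; first by rewrite subn0 qpoch0 expr0 !mulr1.
rewrite qpochS exprSr.
transitivity ((-1) ^+ (n - k) * q ^+ 'C(n - k, 2) / qpoch q q (n - k)
   * ((1 - q ^- n * q ^+ k) * q)).
  by rewrite -(IHk (ltnW kn)); ring.
rewrite subnS; case E : (n - k)%N => [|i]; first by lia.
have -> : q ^+ n = q ^+ i.+1 * q ^+ k by rewrite -exprD; congr (_ ^+ _); lia.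
rewrite /= qpochqS binS bin1 exprD !exprS.
move: (oneBq0 i) (expf_neq0 i q0) (expf_neq0 k q0); rewrite exprS.
move: (q ^+ i) (q ^+ k) => x y x1 x0 y0; field.
by rewrite qq0 q0 x0 y0 x1.
Qed.

Section PartialSum.
Variables (al : K) (g : nat -> K).

Let coef n k := well_poised q al n * (-1) ^+ n * q ^+ 'C(n, 2) / qpoch q q n
  * (qpoch q (q ^- n) k * qpoch q (al * q ^+ n) k / qpoch q q k * q ^+ k).

Let coef0 : coef 0 0 = qpoch q (al * q) 0 * qweight 0 0.
Proof.
by rewrite /coef /qweight !qpoch0 /= !expr0 !(mulr1, divr1).
Qed.

(** The term of index [n.+1] is the increment of the weighted mean. After
    division by the common factors this is
      [1 - al q^(2n+2) = (1 - q^(n+1-k)) + q^(n+1-k) (1 - al q^(n+1+k))]. *)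
Let coefS n k : (k <= n.+1)%N -> coef n.+1 k =
  qpoch q (al * q) (n.+1 + k) * qweight n.+1 k
  - (if (k <= n)%N then qpoch q (al * q) (n + k) * qweight n k else 0).
Proof.
move=> kn.
have -> : coef n.+1 k = (1 - al * q ^+ (2 * n.+1)) * qpoch q (al * q) (n + k)
   * ((-1) ^+ (n.+1 - k) * q ^+ 'C(n.+1 - k, 2) / qpoch q q (n.+1 - k))
   / qpoch q q k.
  rewrite -qpoch_qVn // qpochD /coef /well_poised -(mulrA al) -exprS; ring.
rewrite /qweight; have [kn'|nk] := leqP k n.
  rewrite addSn qpochS subSn //; set i := (n - k)%N.
  have -> : q ^+ (2 * n.+1) = q ^+ (i.+1) * (q * q ^+ (n + k)).
    by rewrite -exprS -exprD; congr (_ ^+ _); rewrite /i; lia.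
  rewrite /= qpochqS (binS i.+1 1) bin1 !exprD (exprS (-1)).
  move: (q ^+ i.+1) (oneBq0 i) => x x1; field.
  by rewrite !qq0 x1.
have -> : k = n.+1 by lia.
rewrite subnn addSn (qpochS (al * q)) qpoch0 /= !expr0 subr0 -(mulrA al) -exprS.
have -> : (2 * n.+1 = (n + n.+1).+1)%N by lia.
by rewrite divr1 !mulr1 !mul1r; ring.
Qed.

(** The exchange of summations in the partial sums: summing [coefS] over [n]
    telescopes, so that each [g k] is left with a single coefficient. *)
Lemma partial_sumE N :
  \sum_(n < N.+1) well_poised q al n * (-1) ^+ n * q ^+ 'C(n, 2) / qpoch q q n
    * \sum_(k < n.+1) (qpoch q (q ^- n) k * qpoch q (al * q ^+ n) k
                         / qpoch q q k * q ^+ k) * g k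
  = \sum_(k < N.+1) qweight N k * (g k * qpoch q (al * q) (N + k)).
Proof.
elim: N => [|N IHN].
  rewrite !big_ord_recl !big_ord0 !addr0 mulrA [LHS](congr1 (fun x => x * g 0) coef0).
  by rewrite addn0; ring.
rewrite big_ord_recr IHN /= mulr_sumr.
have E (k : 'I_N.+2) : true -> well_poised q al N.+1 * (-1) ^+ N.+1 * q ^+ 'C(N.+1, 2)
   / qpoch q q N.+1 * ((qpoch q (q ^- N.+1) k * qpoch q (al * q ^+ N.+1) k
      / qpoch q q k * q ^+ k) * g k)
   = qweight N.+1 k * (g k * qpoch q (al * q) (N.+1 + k))
   - (if (k <= N)%N then qweight N k * (g k * qpoch q (al * q) (N + k)) else 0).
  move=> _; have kN : (k <= N.+1)%N by rewrite -ltnS.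
  rewrite mulrA [LHS](congr1 (fun x => x * g k) (coefS kN)).
  by case: ifP => _; ring.
rewrite (eq_bigr _ E) sumrB [X in _ + (_ - X)]big_ord_recr /= ltnn addr0.
rewrite addrC -[RHS]addr0 -addrA; congr (_ + _).
rewrite addrC; apply/eqP; rewrite subr_eq0; apply/eqP/eq_bigr => k _.
by rewrite -ltnS ltn_ord.
Qed.

End PartialSum.
End Algebra.

(** * Summation by means of total weight one *)

Section Toeplitz.
Variable K : numFieldType.

(** Toeplitz' theorem, for an array [x N k] in place of a sequence [x k]. For a
    fixed [M] the entries with [k < M] contribute little because finitely many
    null sequences of weights meet bounded entries; the others are uniformly
    close to [l], and the weights have bounded total mass. *)
Lemma toeplitz (w x : nat -> nat -> K) (l B C : K) :
  (forall N, \sum_(k < N.+1) w N k = 1) ->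
  (forall N, \sum_(k < N.+1) `|w N k| <= C) ->
  (forall k, (w N k : K^o) @[N --> \oo] --> (0 : K^o)) ->
  (forall N k, `|x N k| <= B) ->
  (forall e : K, 0 < e -> exists M, forall N k, (M <= k)%N -> (M <= N)%N ->
     `|l - x N k| <= e) ->
  (\sum_(k < N.+1) w N k * x N k : K^o) @[N --> \oo] --> (l : K^o).
Proof.
move=> w1 wC w0 xB xl; apply/cvgrPdist_le => e e0.
have C0 : 0 < C.
  apply: lt_le_trans (wC 0%N); have := w1 0%N; rewrite !big_ord1 => ->.
  by rewrite normr1.
have B0 : 0 <= B by apply: le_trans (xB 0%N 0%N).
have D0 : 0 < `|l| + B + 1 by rewrite ltr_wpDl ?addr_ge0.
have e2 : 0 < e / 2 by rewrite divr_gt0.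
have [M xM] := xl _ (divr_gt0 e2 C0).
have head0 : (\sum_(k < M) `|w N k| : K^o) @[N --> \oo] --> (0 : K^o).
  have := @cvg_big K^o 'I_M +%R 0 xpredT (@add_continuous K^o) nat \oo
    (index_enum 'I_M) (fun k N => `|w N k|) (fun=> 0) _.
  rewrite big1_eq; apply => k _.
  by apply/norm_cvg0P/w0.
near=> N.
have MN : (M <= N.+1)%N by near: N; exists M => // N /= /leqW.
(* Total weight one lets l be distributed over the entries. *)
have -> : l - \sum_(k < N.+1) w N k * x N k = \sum_(k < N.+1) w N k * (l - x N k).
  rewrite -[l in LHS]mul1r -(w1 N) mulr_suml -sumrB.
  by apply: eq_bigr => k _; rewrite mulrBr.
apply: le_trans (ler_norm_sum _ _ _) _.
rewrite -(big_mkord xpredT (fun k => `|w N k * (l - x N k)|)).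
rewrite (big_cat_nat (n := M)) //= (splitr e); apply: lerD.
  apply: (@le_trans _ _ ((\sum_(k < M) `|w N k|) * (`|l| + B + 1))).
    rewrite big_mkord mulr_suml; apply: ler_sum => k _.
    rewrite normrM ler_wpM2l // (le_trans (ler_normB _ _)) //.
    by rewrite (le_trans (lerD (lexx _) (xB N k))) // ler_wpDr.
  rewrite -ler_pdivlMr //.
  have : `|\sum_(k < M) `|w N k| | <= e / 2 / (`|l| + B + 1).
    by near: N; apply: (cvgr0_norm_le _ head0); rewrite divr_gt0.
  by rewrite ger0_norm // sumr_ge0.
apply: (@le_trans _ _ ((\sum_(k < N.+1) `|w N k|) * (e / 2 / C))); last first.
  by rewrite -ler_pdivlMr ?divr_gt0 // invf_div mulrC divfK ?gt_eqF.
rewrite -(big_mkord xpredT (fun k => `|w N k|)).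
rewrite [X in X * _](big_cat_nat (n := M)) //=.
rewrite mulrDl ler_wpDl //; first by rewrite mulr_ge0 ?sumr_ge0 // divr_ge0 // ltW.
rewrite mulr_suml; apply: ler_sum_nat => k /andP[Mk kN].
rewrite normrM ler_wpM2l // xM //.
by rewrite (leq_trans Mk).
Unshelve. all: by end_near. Qed.

Lemma cvgM_array (u v : nat -> K) (a b : K) :
  (u n : K^o) @[n --> \oo] --> (a : K^o) ->
  (v n : K^o) @[n --> \oo] --> (b : K^o) ->
  forall e : K, 0 < e -> exists M, forall N k, (M <= k)%N -> (M <= N)%N ->
     `|a * b - u k * v (N + k)%N| <= e.
Proof.
move=> ua vb e e0.
have uv : (u p.1 * v p.2 : K^o) @[p --> filter_prod \oo \oo] --> (a * b : K^o).
  by apply: cvgM; [apply: cvg_comp ua; exact: cvg_fst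
                 | apply: cvg_comp vb; exact: cvg_snd].
have /cvgrPdist_le /(_ e e0) [[P Q] /= [[M _ MP] [M' _ MQ]] PQ] := uv.
exists (maxn M M') => N k; rewrite !geq_max => /andP[Mk Mk'] _.
by apply: (PQ (k, (N + k)%N)); split; [exact: MP | apply: MQ => /=; lia].
Qed.

End Toeplitz.

(** * Infinite products over the complex numbers *)

Section Products.
Variable R : realType.

Lemma cvg_complex (u v : nat -> R) (a b : R) : u @ \oo --> a -> v @ \oo --> b ->
  (u n +i* v n : R[i]^o) @[n --> \oo] --> (a +i* b : R[i]^o).
Proof.
move=> ua vb; apply/cvgrPdist_le => -[e z]; rewrite ltcE /= => /andP[/eqP-> e0].
have e2 : 0 < e / 2 by rewrite divr_gt0.
near=> n; apply: (@le_trans _ _ (`|a - u n|%:C + `|b - v n|%:C)).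
  rewrite normc_def /= -rmorphD /= lecR.
  rewrite -[leRHS]ger0_norm ?addr_ge0 // -sqrtr_sqr ler_wsqrtr //.
  rewrite [leRHS]sqrrD !real_normK ?num_real // -addrA lerD2l lerDr.
  by rewrite mulrn_wge0 // mulr_ge0.
rewrite -rmorphD /= lecR [leRHS]splitr; apply: lerD; near: n.
  by move/cvgrPdist_le : ua => /(_ _ e2).
by move/cvgrPdist_le : vb => /(_ _ e2).
Unshelve. all: by end_near. Qed.

Variable q : R.
Hypothesis hq : 0 < q < 1.

Let q_norm : `|q| < 1.
Proof. by case/andP: hq => q0 q1; rewrite gtr0_norm. Qed.

Lemma cvg_geometric_steps (u : nat -> R) (c : R) :
  (forall n, `|u n.+1 - u n| <= c * q ^+ n) -> cvgn u.
Proof.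
move=> uc; have [q0 q1] := andP hq.
have c0 : 0 <= c by have := uc 0%N; rewrite expr0 mulr1; apply: le_trans.
have -> : u = cst (u 0%N) \+ series (fun n => u n.+1 - u n).
  by apply/funext => n; rewrite /= seriesEnat /= telescope_sumr // addrC subrK.
apply: is_cvgD; first exact: is_cvg_cst.
apply: normed_cvg; apply: (@series_le_cvg _ _ (geometric c q)) => [n|n|n|].
- exact: normr_ge0.
- by rewrite /= mulr_ge0 // exprn_ge0 // ltW.
- exact: uc.
- exact: is_cvg_geometric_series.
Qed.

(** A completeness argument for complex sequences, carried out on the real and
    imaginary parts, where completeness of the reals applies. *)
Lemma cvg_geometric_stepsC (u : nat -> R[i]) (c : R) :
  (forall n, `|u n.+1 - u n| <= (c * q ^+ n)%:C) -> cvgn (u : nat -> R[i]^o).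
Proof.
move=> uc.
have reP : cvgn ((fun n => complex.Re (u n)) : nat -> R).
  apply: (@cvg_geometric_steps _ c) => n; rewrite -lecR.
  by apply: le_trans (uc n); rewrite -raddfB; exact: normc_ge_Re.
have imP : cvgn ((fun n => complex.Im (u n)) : nat -> R).
  apply: (@cvg_geometric_steps _ c) => n; rewrite -lecR.
  apply: le_trans (uc n); rewrite -raddfB.
  case: (u n.+1 - u n) => x y; rewrite /= normc_def lecR /=.
  by rewrite -sqrtr_sqr ler_wsqrtr // lerDr sqr_ge0.
have -> : u = fun n => complex.Re (u n) +i* complex.Im (u n).
  by apply/funext => n; case: (u n).
by apply/cvg_ex; eexists; apply: cvg_complex; [exact: reP | exact: imP].
Qed.

(** From [1 + t <= exp t], the product is at most the exponential of a geometric
    series. *)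
Lemma prod_bound (a : nat -> R[i]) (c : R) : 0 <= c ->
  (forall k, `|a k| <= (c * q ^+ k)%:C) ->
  forall n, `|\prod_(k < n) (1 + a k)| <= (expR (c / (1 - q)))%:C.
Proof.
move=> c0 ac n; have [q0 q1] := andP hq.
apply: (@le_trans _ _ (expR (series (geometric c q) n))%:C); last first.
  by rewrite lecR ler_expR geometric_le_lim.
elim: n => [|n IHn]; first by rewrite big_ord0 normr1 seriesEnat /= big_nil expR0.
rewrite big_ord_recr /= normrM seriesSr /= expRD rmorphM; apply: ler_pM => //.
apply: (@le_trans _ _ (1 + c * q ^+ n)%:C); last by rewrite lecR expR_ge1Dx.
by rewrite (le_trans (ler_normD _ _)) // normr1 rmorphD /= lerD2l ac.
Qed.

(** Consecutive partial products differ by [a n] times a partial product, and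
    the partial products are bounded, so the steps decay geometrically. *)
Lemma cvg_prod1D (a : nat -> R[i]) (c : R) :
  (forall k, `|a k| <= (c * q ^+ k)%:C) ->
  cvgn (fun n => \prod_(k < n) (1 + a k) : R[i]^o).
Proof.
move=> ac; have c0 : 0 <= c.
  by have := le_trans (normr_ge0 _) (ac 0%N); rewrite expr0 mulr1 lecR.
apply: (@cvg_geometric_stepsC _ (expR (c / (1 - q)) * c)) => n.
rewrite big_ord_recr /= mulrDr mulr1 addrC addKr normrM -mulrA rmorphM.
by apply: ler_pM => //; exact: prod_bound.
Qed.

Lemma cvg_qpoch (x : R[i]) :
  qpoch q%:C x n @[n --> \oo] --> (qpoch_inf q%:C x : R[i]^o).
Proof.
suff: cvgn (qpoch q%:C x : nat -> R[i]^o) by [].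
have [q0 _] := andP hq.
apply: (@cvg_prod1D (fun k => - (x * q%:C ^+ k)) (complex.Re `|x|)) => k.
rewrite normrN normrM normrX rmorphM rmorphXn /=.
rewrite (RRe_real (normr_real x)) [`|q%:C|]ger0_norm // lecR; exact: ltW.
Qed.

Lemma oneB_qpow_neq0 (x : R[i]) k : `|x| < 1 -> 1 - x * q%:C ^+ k != 0.
Proof.
move=> x1; rewrite subr_eq0; apply/eqP => E; have [q0 q1] := andP hq.
have : `|x * q%:C ^+ k| < 1.
  rewrite normrM normrX [`|q%:C|]ger0_norm ?lecR; last exact: ltW.
  rewrite (le_lt_trans _ x1) // ler_piMr // -rmorphXn lecR exprn_ile1 //; exact: ltW.
by rewrite -E normr1 ltxx.
Qed.

Lemma qpoch_neq0 (x : R[i]) n : `|x| < 1 -> qpoch q%:C x n != 0.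
Proof. by move=> x1; apply/prodf_neq0 => k _; exact: oneB_qpow_neq0. Qed.

(** The inverses of the partial products converge too, by the same criterion,
    since [1 / (1 - t) = 1 + t / (1 - t)]. The limit of the products and that of
    their inverses multiply to 1. *)
Lemma qpoch_inf_neq0 (x : R[i]) : `|x| < 1 -> qpoch_inf q%:C x != 0.
Proof.
move=> x1; have [q0 q1] := andP hq.
have qn : `|q%:C| = q%:C by rewrite ger0_norm // lecR ltW.
pose a k := x * q%:C ^+ k / (1 - x * q%:C ^+ k).
have aE k : 1 + a k = (1 - x * q%:C ^+ k)^-1.
  by rewrite /a; field; exact: oneB_qpow_neq0.
have [l lP] : exists l : R[i]^o, (\prod_(k < n) (1 + a k) : R[i]^o) @[n --> \oo] --> l.
  pose r := `|x| / (1 - `|x|).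
  have rE : (complex.Re r)%:C = r.
    by rewrite RRe_real // rpredM ?rpredV ?rpredB ?rpred1 // normr_real.
  apply/cvg_ex; apply: (@cvg_prod1D _ (complex.Re r)) => k.
  rewrite rmorphM rmorphXn /= rE /r /a normrM normfV normrM normrX qn mulrAC.
  apply: ler_wpM2r; first by rewrite -rmorphXn lecR exprn_ge0 // ltW.
  apply: ler_wpM2l => //; rewrite lef_pV2 ?posrE ?subr_gt0 ?normr_gt0 ?oneB_qpow_neq0 //.
  apply: le_trans (lerB_dist _ _); rewrite normr1 lerD2l lerN2 normrM normrX qn.
  by rewrite ler_piMr // -rmorphXn lecR exprn_ile1 // ltW.
have := cvgM (@cvg_qpoch x) lP.
have -> : qpoch q%:C x \* (fun n => \prod_(k < n) (1 + a k)) = cst (1 : R[i]^o).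
  apply/funext => n; rewrite /= /qpoch -big_split /= big1 // => k _.
  by rewrite aE divff // oneB_qpow_neq0.
move=> /(_ _) /(cvg_unique (@norm_hausdorff _ R[i]^o) (cvg_cst _)) E.
by apply/eqP => x0; move/eqP: E; rewrite x0 mul0r oner_eq0.
Qed.

End Products.

(** * The expansion of a convergent sequence *)

Section Expansion.
Variables (R : realType) (q0 : R).
Hypothesis hq : 0 < q0 < 1.
Let q : R[i] := q0%:C.

Lemma cvg_bound (u : nat -> R[i]) (l : R[i]) :
  (u n : R[i]^o) @[n --> \oo] --> (l : R[i]^o) -> exists B, forall n, `|u n| <= B.
Proof.
move=> ul; have /cvg_seq_bounded : cvgn (u : nat -> R[i]^o) by apply/cvg_ex; exists l.
by move=> /pinfty_ex_gt0[B _ uB]; exists B => n; exact: uB.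
Qed.

Let q_ge0 : 0 <= q.
Proof. by rewrite lecR ltW //; case/andP: hq. Qed.

Let q_norm : `|q| < 1.
Proof. by rewrite ger0_norm // ltcR; case/andP: hq. Qed.

Let q_neq0 : q != 0.
Proof. by case/andP: hq => q_gt0 _; rewrite eq_complex /= gt_eqF. Qed.

Let qq_neq0 n : qpoch q q n != 0.
Proof. exact: qpoch_neq0. Qed.

Lemma cvg_qpow0 : (q ^+ n : R[i]^o) @[n --> \oo] --> (0 : R[i]^o).
Proof.
have -> : (fun n => q ^+ n) = (fun n => (q0 ^+ n) +i* (cst 0 n)).
  by apply/funext => n; rewrite /q -rmorphXn.
apply: cvg_complex; last exact: cvg_cst.
have q01 : `|q0| < 1 by case/andP: hq => q_gt0 q_lt1; rewrite gtr0_norm.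
exact: cvg_expr.
Qed.

(** Since ['C(i + 1, 2) >= i], the weights decay geometrically away from
    [k = N]; the factors [1 / (q; q)_n] are bounded because [(q; q)_oo <> 0]. *)
Lemma qweight_bound : exists2 D : R[i], 0 <= D &
  forall N k, `|qweight q N k| <= D * q ^+ (N - k).
Proof.
have iq : ((qpoch q q n)^-1 : R[i]^o) @[n --> \oo] --> ((qpoch_inf q q)^-1 : R[i]^o).
  by apply: cvgV; [exact: qpoch_inf_neq0 | exact: cvg_qpoch].
have [D DP] := cvg_bound iq.
have D0 : 0 <= D by apply: le_trans (DP 0%N).
exists (D * D) => [|N k]; first exact: mulr_ge0.
rewrite /qweight binS bin1 exprD invfM !normrM !normrX normrN1 expr1n mul1r.
rewrite (ger0_norm q_ge0) mulrC; apply: ler_pM => //.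
- by rewrite mulr_ge0 // exprn_ge0.
- by apply: ler_pM.
- rewrite ler_piMl ?exprn_ge0 // exprn_ile1 //.
  by rewrite -(ger0_norm q_ge0) ltW.
Qed.

(** The weights satisfy the hypotheses of Toeplitz' theorem: their geometric
    bound gives both the bounded total mass and, for fixed [k], the limit 0. *)
Lemma cvg_qweight (x : nat -> nat -> R[i]) (l B : R[i]) :
  (forall N k, `|x N k| <= B) ->
  (forall e : R[i], 0 < e -> exists M, forall N k, (M <= k)%N -> (M <= N)%N ->
     `|l - x N k| <= e) ->
  (\sum_(k < N.+1) qweight q N k * x N k : R[i]^o) @[N --> \oo] --> (l : R[i]^o).
Proof.
move=> xB xl; have [D D0 kD] := qweight_bound.
have q1 : 0 < 1 - q by rewrite subr_gt0 -(ger0_norm q_ge0).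
apply: (toeplitz (C := D / (1 - q)) _ _ _ xB xl) => [N|N|k].
- exact: sum_qweight.
- apply: le_trans (ler_sum _ (fun (k : 'I_N.+1) _ => kD N k)) _.
  rewrite -mulr_sumr ler_wpM2l // -[leRHS]mul1r ler_pdivlMr //.
  rewrite (reindex_inj rev_ord_inj) /=.
  under eq_bigr => k _ do rewrite subSS subKn -1?ltnS //.
  by rewrite mulrC -opprB mulNr -subrX1 opprB gerBl exprn_ge0.
- rewrite -(cvg_shiftn k); apply/cvgr0Pnorm_le => e e0.
  have Dq : (D * q ^+ N : R[i]^o) @[N --> \oo] --> (0 : R[i]^o).
    rewrite -(mulr0 D); apply: cvgM; [exact: cvg_cst | exact: cvg_qpow0].
  near=> N; apply: le_trans (kD _ _) _; rewrite addnK.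
  have : `|D * q ^+ N| <= e by near: N; exact: cvgr0_norm_le Dq _ e0.
  by rewrite ger0_norm // mulr_ge0 // exprn_ge0.
Unshelve. all: by end_near. Qed.

(** The theorem for an arbitrary convergent sequence [g] in place of the quotient
    of q-Pochhammer symbols. *)
Lemma cvg_expansion (al : R[i]) (g : nat -> R[i]) (G : R[i]) :
  (g n : R[i]^o) @[n --> \oo] --> (G : R[i]^o) ->
  series (fun n => well_poised q al n * (-1) ^+ n * q ^+ 'C(n, 2) / qpoch q q n
    * \sum_(k < n.+1) (qpoch q (q ^- n) k * qpoch q (al * q ^+ n) k
                         / qpoch q q k * q ^+ k) * g k : R[i]^o) @ \oo
  --> (G * qpoch_inf q (al * q) : R[i]^o).
Proof.
move=> gG; rewrite -cvg_shiftS.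
under eq_fun do rewrite /= seriesEnat /= big_mkord partial_sumE //.
have vV : (qpoch q (al * q) n : R[i]^o) @[n --> \oo] --> (qpoch_inf q (al * q) : R[i]^o).
  exact: cvg_qpoch.
have [A gA] := cvg_bound gG; have [B vB] := cvg_bound vV.
apply: (@cvg_qweight (fun N k => g k * qpoch q (al * q) (N + k)) _ (A * B)).
  by move=> N k; rewrite normrM ler_pM.
exact: (@cvgM_array R[i] _ _ _ _ gG vV).
Qed.

End Expansion.

Theorem theorem1p5 (R : realType) (q0 : R) (hq : 0 < q0 < 1)
    (m : nat) (alpha b : R[i]) (bs cs : 'I_m -> R[i])
    (hb : `|alpha * b| < 1) (hbs : forall j, `|alpha * bs j| < 1) :
  let q : R[i] := q0%:C in
  series (fun n : nat =>
    well_poised q alpha n * (-1) ^+ n * q ^+ (n * n.-1)./2 / qpoch q q n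
    * hyper q
        [tuple of q ^- n :: alpha * q ^+ n :: [tuple alpha * cs j | j < m]]
        [tuple of alpha * b :: [tuple alpha * bs j | j < m]]
        q : R[i]^o) @ \oo
  --> (qpoch_inf q (alpha * q) / qpoch_inf q (alpha * b)
       * \prod_(j < m) (qpoch_inf q (alpha * cs j)
                        / qpoch_inf q (alpha * bs j)) : R[i]^o).
Proof.
move=> q; have [q0_gt0 _] := andP hq.
have q_neq0 : q != 0 by rewrite /q eq_complex /= gt_eqF.
pose g k : R[i] :=
  (\prod_(j < m) (qpoch q (alpha * cs j) k / qpoch q (alpha * bs j) k))
  / qpoch q (alpha * b) k.
pose G : R[i] :=
  (\prod_(j < m) (qpoch_inf q (alpha * cs j) / qpoch_inf q (alpha * bs j)))
  / qpoch_inf q (alpha * b).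
have inv_cvg y : `|y| < 1 ->
    ((qpoch q y n)^-1 : R[i]^o) @[n --> \oo] --> ((qpoch_inf q y)^-1 : R[i]^o).
  by move=> y1; apply: cvgV; [exact: qpoch_inf_neq0 | exact: cvg_qpoch].
have gG : (g n : R[i]^o) @[n --> \oo] --> (G : R[i]^o).
  apply: cvgM; last exact: inv_cvg.
  have := @cvg_big R[i]^o 'I_m *%R 1 xpredT (@mul_continuous R[i]) nat \oo
    (index_enum 'I_m)
    (fun j n => qpoch q (alpha * cs j) n / qpoch q (alpha * bs j) n)
    (fun j => qpoch_inf q (alpha * cs j) / qpoch_inf q (alpha * bs j)) _.
  by apply => j _; apply: cvgM; [exact: cvg_qpoch | exact: inv_cvg].
have hyperE n : hyper q
    [tuple of q ^- n :: alpha * q ^+ n :: [tuple alpha * cs j | j < m]]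
    [tuple of alpha * b :: [tuple alpha * bs j | j < m]] q
  = \sum_(k < n.+1) (qpoch q (q ^- n) k * qpoch q (alpha * q ^+ n) k
                       / qpoch q q k * q ^+ k) * g k.
  rewrite (@hyper_terminating _ _ _ _ _ _ n) ?mem_head //; apply: eq_bigr => k _.
  rewrite /hyper_term /qpochs /= !big_cons !big_map -!enumT !big_enum /=.
  by rewrite /g prodf_div !invfM; ring.
under eq_fun do rewrite hyperE -bin2.
rewrite mulrAC -mulrA mulrC -/G; exact: cvg_expansion.
Qed.
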